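(* For every positive integer $d$, $$\tau(\mathbb{S}^{d-1})\leq \begin{cases}\frac{1}{2}+\frac{1}{2d}, & \text{if } d \text{ is odd},\\[2pt] \frac{1}{2}+\frac{1}{2(d+1)}, & \text{if } d \text{ is even}.\end{cases}$$
   Context: $\mathbb{S}^{d-1}$ denotes the Euclidean unit sphere in $\mathbb{R}^d$ centred at the origin, and $\mu_{\mathbb{S}^{d-1}}$ its normalised (probability) surface measure (for $d=1$, the uniform probability measure on $\{-1,1\}$). A subset $S\subset\mathbb{R}^d$ is $\Delta$-free if there are no $a,b,c\in S$ (not necessarily distinct) with $a+b+c=0$. Define $$\tau(\mathbb{S}^{d-1})=\sup\{\mu_{\mathbb{S}^{d-1}}(S) : S\subset\mathbb{S}^{d-1}\text{ is Borel and }\Delta\text{-free}\}.$$ *)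

(* Defs.v *)
From HB Require Import structures.
From mathcomp Require Import all_boot all_order all_algebra.
From mathcomp Require Import all_classical all_reals all_analysis.
Import Order.TTheory GRing.Theory Num.Theory.
Import numFieldNormedType.Exports.

Set Implicit Arguments.
Unset Strict Implicit.
Unset Printing Implicit Defensive.

Local Open Scope classical_set_scope.
Local Open Scope ring_scope.

(* The d-fold product of the Lebesgue measure of the line, on R^d = 'rV[R]_d.
   The recursion is the definition of the product measure
   [lebesgue_measure \x lebesgue_rV d], with R * 'rV_d read as 'rV_(1 + d).
   It is meaningful on Borel sets; elsewhere the value is irrelevant. *)
Fixpoint lebesgue_rV (R : realType) (d : nat) : set 'rV[R]_d -> \bar R :=
  match d with
  | 0 => fun A => (\1_A (0 : 'rV[R]_0))%:E
  | n.+1 => fun A => (\int[lebesgue_measure]_(x in [set: R])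
      lebesgue_rV [set v : 'rV[R]_n | A (row_mx (x%:M : 'rV[R]_1) v)])%E
  end.

Definition borel_rV (R : realType) (d : nat) (A : set 'rV[R]_d) : Prop :=
  <<s [set U : set 'rV[R]_d | open U] >> A.

(* The library norm `|x| on 'rV[R]_d is the sup norm, hence this definition. *)
Definition enorm (R : realType) (d : nat) (x : 'rV[R]_d) : R :=
  Num.sqrt (\sum_(i < d) x ord0 i ^+ 2).

Definition usphere (R : realType) (d : nat) : set 'rV[R]_d :=
  [set x | enorm x = 1].

Definition cone (R : realType) (d : nat) (S : set 'rV[R]_d) : set 'rV[R]_d :=
  [set t *: x | t in `[0, 1] & x in S].

(* Surface measure of a Borel subset S of the unit sphere, from polar
   coordinates: the cone over S with apex the origin has d-dimensional volume
   \int_0^1 r^(d-1) sigma(S) dr = sigma(S) / d. For d = 1 this is the counting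
   measure on {-1, 1}. *)
Definition surface_measure (R : realType) (d : nat) (S : set 'rV[R]_d)
    : \bar R :=
  (d%:R%:E * lebesgue_rV (cone S))%E.

Definition sphere_prob (R : realType) (d : nat) (S : set 'rV[R]_d) : \bar R :=
  (surface_measure S / surface_measure (@usphere R d))%E.

Definition Delta_free (R : realType) (d : nat) (S : set 'rV[R]_d) : Prop :=
  ~ exists a b c : 'rV[R]_d, [/\ S a, S b, S c & a + b + c = 0].

Definition tau (R : realType) (d : nat) : \bar R :=
  ereal_sup [set sphere_prob S | S in
    [set S : set 'rV[R]_d | [/\ S `<=` @usphere R d, borel_rV S & Delta_free S]]].

(* Main.v *)
Require Import Defs.
From HB Require Import structures.
From mathcomp Require Import all_boot all_order all_algebra.
From mathcomp Require Import all_classical all_reals all_analysis.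
From mathcomp Require Import perm measurable_realfun zify ring lra.
Import Order.TTheory GRing.Theory Num.Theory.
Import numFieldNormedType.Exports.
Set Implicit Arguments.
Unset Strict Implicit.
Unset Printing Implicit Defensive.
Local Open Scope classical_set_scope.
Local Open Scope ring_scope.

(* Let u_0, ..., u_d be the vertices of a regular simplex of side 1 in R^d. The
   d (d + 1) vectors u_i - u_j are unit vectors and
   (u_i - u_j) + (u_j - u_k) + (u_k - u_i) = 0, so the pairs (i, j) for which
   u_i - u_j lies in a rotated copy of a Delta-free set S form a digraph on
   d + 1 vertices without directed triangles; such a digraph has at most
   (d + 1)^2 / 2 arcs. Averaging over all rotations gives
   d (d + 1) mu(S) <= floor ((d + 1)^2 / 2).

   Haar measure on O(d) is replaced by the Gram-Schmidt orthonormalization of a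
   matrix picked at random (for the Lebesgue measure of R^(d * d)) in a ball.
   Its law is invariant under right multiplication by orthogonal matrices, so
   the probability that it sends a unit vector v into S does not depend on v;
   integrating over v in the unit ball, this probability is mu(S). The
   invariance of the Lebesgue measure under linear isometries follows from its
   uniqueness as a translation-invariant measure, normalized on the unit ball. *)

(** * Measurable structure on row vectors *)

Definition coord_cylinders (R : realType) (n : nat) : set (set 'rV[R]_n) :=
  [set B | exists i : 'I_n, exists2 A : set R, measurable A &
             B = (fun x : 'rV[R]_n => x ord0 i) @^-1` A].

Section measurable_row.
Variables (R : realType) (n : nat).

Let mrow (A : set 'rV[R]_n) := <<s @coord_cylinders R n >> A.
Let mrow0 : mrow set0. Proof. exact: sigma_algebra0. Qed.
Let mrowC A : mrow A -> mrow (~` A). Proof. exact: sigma_algebraC. Qed.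
Let mrow_bigcup (F : (set 'rV[R]_n)^nat) :
  (forall i, mrow (F i)) -> mrow (\bigcup_i (F i)).
Proof. exact: sigma_algebra_bigcup. Qed.

(** Generating by coordinate cylinders makes a map into ['rV[R]_n] measurable as soon as its
    coordinates are ([measurable_rVP]); Borel sets are recovered through [open_measurable_rV]. *)
HB.instance Definition _ := @isMeasurable.Build default_measure_display
  'rV[R]_n mrow mrow0 mrowC mrow_bigcup.

End measurable_row.

Section measurable_row_theory.
Context (R : realType).

Lemma measurable_coord n (i : 'I_n) :
  measurable_fun [set: 'rV[R]_n] (fun x => x ord0 i).
Proof.
by move=> _ A mA; rewrite setTI; apply: sub_sigma_algebra; exists i, A.
Qed.

Lemma measurable_rVP d (T : measurableType d) n (f : T -> 'rV[R]_n) :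
  (forall i, measurable_fun [set: T] (fun t => f t ord0 i)) ->
  measurable_fun [set: T] f.
Proof.
move=> mf _ A; rewrite setTI.
suff: @measurable _ 'rV[R]_n `<=` [set A | measurable (f @^-1` A)] by apply.
apply: smallest_sub.
  split => //=; first by rewrite preimage_set0.
    by move=> B mB; rewrite setTD preimage_setC; exact: measurableC.
  by move=> F mF; rewrite preimage_bigcup; exact: bigcupT_measurable.
by move=> _ [i [B mB ->]]; rewrite /= -[X in measurable X]setTI; exact: mf.
Qed.

Lemma row_mx_head n (x : R) (v : 'rV[R]_n) :
  (row_mx (x%:M : 'rV[R]_1) v : 'rV[R]_n.+1) ord0 ord0 = x.
Proof.
transitivity (row_mx (x%:M : 'rV[R]_1) v ord0 (@lshift 1 n ord0)).
  by congr (row_mx _ _ _ _); exact: val_inj.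
by rewrite row_mxEl mxE.
Qed.

Lemma row_mx_tail n (x : R) (v : 'rV[R]_n) (j : 'I_n) :
  (row_mx (x%:M : 'rV[R]_1) v : 'rV[R]_n.+1) ord0 (lift ord0 j) = v ord0 j.
Proof.
transitivity (row_mx (x%:M : 'rV[R]_1) v ord0 (@rshift 1 n j)).
  by congr (row_mx _ _ _ _); exact: val_inj.
by rewrite row_mxEr.
Qed.

Lemma measurable_row_mx n :
  measurable_fun [set: R * 'rV[R]_n]
    (fun p => row_mx (p.1%:M : 'rV[R]_1) p.2).
Proof.
apply: measurable_rVP => i; case: (split_ordP i) => j ->.
  under eq_fun do rewrite row_mxEl mxE (ord1 j) eqxx mulr1n.
  exact: measurable_fst.
under eq_fun do rewrite row_mxEr.
apply: (measurableT_comp (measurable_coord j)); exact: measurable_snd.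
Qed.

Lemma measurable_unrow_mx n :
  measurable_fun [set: 'rV[R]_(1 + n)]
    (fun x : 'rV[R]_(1 + n) => (x ord0 ord0, rsubmx x)).
Proof.
apply: measurable_fun_pair; first exact: measurable_coord.
apply: measurable_rVP => i; under eq_fun do rewrite mxE.
exact: measurable_coord.
Qed.

Definition cube n (c : 'rV[R]_n) (e : R) : set 'rV[R]_n :=
  [set x | forall i, `|x ord0 i - c ord0 i| < e].

Lemma measurable_cube n (c : 'rV[R]_n) (e : R) : measurable (cube c e).
Proof.
have -> : cube c e = \bigcap_(i : 'I_n)
    ((fun x : 'rV[R]_n => x ord0 i) @^-1` `]c ord0 i - e, c ord0 i + e[).
  apply/seteqP; split=> x /= h i; first by move=> _; rewrite /= in_itv/= -ltr_distl.
  by have := h i Logic.I; rewrite /= in_itv/= -ltr_distl.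
apply: fin_bigcap_measurable => // i _; rewrite -[X in measurable X]setTI.
by apply: measurable_coord => //; exact: measurable_itv.
Qed.

Lemma open_cubeP n (U : set 'rV[R]_n) (x : 'rV[R]_n) : open U -> U x ->
  exists2 e : R, 0 < e & cube x e `<=` U.
Proof.
move=> oU Ux; have /nbhs_ballP[e e0 eU] := open_nbhs_nbhs (conj oU Ux).
exists e => // y xy; apply: eU; split=> // i j.
by rewrite ord1 /ball/= distrC.
Qed.

(** An open set is the union of the cubes with rational centre and half-side [1 / (k + 1)] that it
    contains, and there are countably many of these. *)
Lemma open_measurable_rV n (U : set 'rV[R]_n) : open U -> measurable U.
Proof.
move=> oU.
pose box (p : 'rV[rat]_n * nat) := cube (map_mx ratr p.1) p.2.+1%:R^-1.
have -> : U = \bigcup_p (if `[< box p `<=` U >] then box p else set0).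
  apply/seteqP; split=> [x Ux|x [p _]]; last by case: asboolP => // + bx; apply.
  have [e e0 xU] := open_cubeP oU Ux.
  (* This [k] gives [1 / (k + 1) <= e / 2]: a rational centre that close to [x] has a cube
     containing [x] and lying within [e] of it. *)
  pose k := Num.truncn (2 / e).
  have k0 : (0 : R) < k.+1%:R^-1 by rewrite invr_gt0 ltr0n.
  have ke : k.+1%:R^-1 <= e / 2.
    by rewrite -[leRHS]invrK invf_div lef_pV2 ?posrE ?divr_gt0// ?ltW// truncnS_gt.
  have /choice[q qP] : forall i, exists q : rat, `|x ord0 i - ratr q| < k.+1%:R^-1.
    move=> i; have /rat_in_itvoo[q] : x ord0 i < x ord0 i + k.+1%:R^-1 by rewrite ltrDl.
    by rewrite inE/= => /itvP qi; exists q; rewrite distrC ger0_norm ?subr_ge0 ?ltrBlDl qi.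
  exists (\row_i q i, k) => //.
  case: asboolP => [_ i|[]]; first by rewrite !mxE.
  move=> y /= yq; apply: xU => i.
  have yq' j : `|y ord0 j - ratr (q j)| < k.+1%:R^-1 by have := yq j; rewrite !mxE.
  have -> : y ord0 i - x ord0 i = (y ord0 i - ratr (q i)) - (x ord0 i - ratr (q i)) by ring.
  apply: (le_lt_trans (ler_normB _ _)); apply: (lt_le_trans (ltrD (yq' i) (qP i))).
  by rewrite [leRHS](splitr e) lerD.
apply: countable_bigcupT_measurable; first exact: countableP.
by move=> p; case: asboolP => // _; exact: measurable_cube.
Qed.

Lemma borel_measurable_rV n (A : set 'rV[R]_n) : borel_rV A -> measurable A.
Proof.
apply: smallest_sub; first exact: sigma_algebra_measurable.
by move=> U; exact: open_measurable_rV.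
Qed.

End measurable_row_theory.

(** * Lebesgue measure on [R^n] as a sigma-finite measure *)

Section as_sigma_finite.
Context d (T : measurableType d) (R : realType).
Variables (m : {measure set T -> \bar R}) (sm : sigma_finite setT m).

Let m' : set T -> \bar R := m.
HB.instance Definition _ := Measure.on m'.
HB.instance Definition _ := @Measure_isSigmaFinite.Build _ _ _ m' sm.

Lemma as_sigma_finite :
  exists mu : {sigma_finite_measure set T -> \bar R}, mu = m :> (set T -> \bar R).
Proof. by exists [the {sigma_finite_measure set T -> \bar R} of m']. Qed.

End as_sigma_finite.

(** A cover of the source by sets of finite measure is carried over by preimages under [g]; since
    [g \o f = id], their pushforward measure is the original one. *)
Lemma sigma_finite_pushforward d (T : measurableType d) d'
    (T' : measurableType d') (R : realType) (m : {measure set T -> \bar R})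
    (f : T -> T') (g : T' -> T) :
  measurable_fun setT f -> measurable_fun setT g -> cancel f g ->
  sigma_finite setT m ->
  exists mu : {sigma_finite_measure set T' -> \bar R},
    mu = pushforward m f :> (set T' -> \bar R).
Proof.
move=> mf mg fK [F FT mF].
pose m' : {measure set T' -> \bar R} :=
  measure_function_pushforward__canonical__measure_function_Measure m mf.
have m'E : m' = pushforward m f :> (set T' -> \bar R) by [].
have sm' : sigma_finite setT m'.
  exists (fun k => g @^-1` F k); first by rewrite -preimage_bigcup -FT preimage_setT.
  move=> k; split.
    by rewrite -[X in measurable X]setTI; apply: mg => //; apply: (mF k).1.
  rewrite m'E /pushforward -comp_preimage (_ : g \o f = id) ?(mF k).2//.
  exact/funext.
have [mu muE] := as_sigma_finite sm'.
by exists mu; rewrite muE.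
Qed.

(** By induction, the measure is the pushforward of the product of [lebesgue_measure] with the
    previous one along [row_mx]; it starts from the Dirac mass at the single point of [R^0]. *)
Lemma lebesgue_rV_ex (R : realType) n :
  exists m : {sigma_finite_measure set 'rV[R]_n -> \bar R},
  forall A : set 'rV[R]_n, measurable A -> m A = lebesgue_rV A.
Proof.
elim: n => [|n [m mE]].
  by exists (dirac (0 : 'rV[R]_0)) => A mA.
pose f (p : measurableTypeR R * 'rV[R]_n) : 'rV[R]_n.+1 := row_mx (p.1%:M : 'rV[R]_1) p.2.
pose g (x : 'rV[R]_n.+1) : measurableTypeR R * 'rV[R]_n := (x ord0 ord0, @rsubmx _ 1 1 n x).
have mf : measurable_fun setT f by exact: measurable_row_mx.
have mg : measurable_fun setT g by exact: measurable_unrow_mx.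
have fK : cancel f g.
  by move=> [a v]; rewrite /f /g /= row_mx_head row_mxKr.
pose leb : {sigma_finite_measure set (measurableTypeR R) -> \bar R} := lebesgue_measure.
have [sigma] :=
  lebesgue_integral_fubini.measure_function_Measure_isSigmaFinite__to__measure_function_isSigmaFinite leb m.
have [mu muE] := sigma_finite_pushforward mf mg fK sigma.
exists mu => A mA; rewrite muE /= /pushforward /= /product_measure1.
apply: eq_integral => x _ /=; rewrite mE; first by rewrite xsectionE.
apply: measurable_xsection.
by rewrite -[X in measurable X]setTI; exact: mf.
Qed.

Definition leb (R : realType) n : {sigma_finite_measure set 'rV[R]_n -> \bar R} :=
  sval (cid (lebesgue_rV_ex R n)).

Section leb_theory.
Context (R : realType).

Lemma lebE n (A : set 'rV[R]_n) : measurable A -> leb R n A = lebesgue_rV A.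
Proof. exact: (svalP (cid (lebesgue_rV_ex R n))). Qed.

Definition head_section n (A : set 'rV[R]_n.+1) (x : R) : set 'rV[R]_n :=
  [set v | A (row_mx (x%:M : 'rV[R]_1) v)].

Lemma head_sectionE n (A : set 'rV[R]_n.+1) (x : R) : head_section A x =
  xsection ((fun p : R * 'rV[R]_n => row_mx (p.1%:M : 'rV[R]_1) p.2) @^-1` A) x.
Proof. by rewrite xsectionE. Qed.

Lemma measurable_row_mx_preimage n (A : set 'rV[R]_n.+1) : measurable A ->
  measurable ((fun p : R * 'rV[R]_n => row_mx (p.1%:M : 'rV[R]_1) p.2) @^-1` A).
Proof. by move=> mA; rewrite -[X in measurable X]setTI; exact: measurable_row_mx. Qed.

Lemma measurable_head_section n (A : set 'rV[R]_n.+1) (x : R) :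
  measurable A -> measurable (head_section A x).
Proof.
by move=> mA; rewrite head_sectionE; apply: measurable_xsection; exact: measurable_row_mx_preimage.
Qed.

Lemma measurable_leb_section n (A : set 'rV[R]_n.+1) : measurable A ->
  measurable_fun [set: R] (fun x => leb R n (head_section A x)).
Proof.
move=> mA; under eq_fun do rewrite head_sectionE.
by apply: measurable_fun_xsection; exact: measurable_row_mx_preimage.
Qed.

Lemma lebS n (A : set 'rV[R]_n.+1) : measurable A ->
  leb R n.+1 A = (\int[lebesgue_measure]_x leb R n (head_section A x))%E.
Proof.
move=> mA; rewrite lebE//=; apply: eq_integral => x _.
by rewrite lebE//; exact: measurable_head_section.
Qed.

Lemma measurable_affine1 (b : bool) (t : R) :
  measurable_fun setT (fun x : R => (-1) ^+ b * x + t).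
Proof. by apply: measurable_funD => //; apply: measurable_funM. Qed.

(** By uniqueness of Lebesgue measure, it suffices to compare lengths on half-open intervals. *)
Lemma lebesgue_measure_affine (b : bool) (t : R) (A : set R) : measurable A ->
  lebesgue_measure ((fun x : R => (-1) ^+ b * x + t) @^-1` A) = lebesgue_measure A.
Proof.
move=> mA; pose f := (fun x : measurableTypeR R => (-1) ^+ b * x + t : measurableTypeR R).
have mf : measurable_fun setT f by exact: measurable_affine1.
pose m := measure_function_pushforward__canonical__measure_function_Measure
  (@lebesgue_measure R) mf.
apply/esym/(@lebesgue_measure_unique R m) => // _ [[x y]] _ <-.
rewrite [RHS](_ : _ = lebesgue_measure (f @^-1` `]x, y]))// /f.
case: b {mf m} @f => /=; last first.
  rewrite (_ : _ @^-1` _ = `]x - t, y - t]%classic); last first.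
    by apply/seteqP; split=> z /=; rewrite !in_itv/= expr0 mul1r ltrBlDr lerBrDr.
  rewrite !lebesgue_measure_itv/= !lte_fin ltrD2r; case: ifP => // _.
  by rewrite -!EFinB; congr EFin; ring.
(* A reflection moves the closed end to the other side; the length is unchanged. *)
rewrite (_ : _ @^-1` _ = `[t - y, t - x[%classic); last first.
  apply/seteqP; split=> z /=; rewrite !in_itv/= expr1 mulN1r => /andP[? ?].
    by apply/andP; split; lra.
  by apply/andP; split; lra.
rewrite !lebesgue_measure_itv/= !lte_fin ltrD2l ltrN2; case: ifP => // _.
by rewrite -!EFinB; congr EFin; ring.
Qed.

Lemma integral_affine (b : bool) (t : R) (f : R -> \bar R) :
  measurable_fun setT f -> (forall x, 0 <= f x)%E ->
  (\int[lebesgue_measure]_x f (((-1) ^+ b * x + t)%R))%E =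
  (\int[lebesgue_measure]_x f x)%E.
Proof.
move=> mf f0.
pose g := (fun x : measurableTypeR R => (-1) ^+ b * x + t : measurableTypeR R).
have mg : measurable_fun setT g by exact: measurable_affine1.
have := @ge0_integral_pushforward _ _ _ _ R g mg lebesgue_measure setT f measurableT mf.
rewrite preimage_setT => <-//.
by apply: eq_measure_integral => A mA _; exact: lebesgue_measure_affine.
Qed.

(** The bit [b] treats translations and point reflections together; [translation_invariant_unique]
    uses both. The induction applies the one-dimensional case to the first coordinate and the
    hypothesis to the sections. *)
Lemma leb_affine n (b : bool) (y : 'rV[R]_n) (A : set 'rV[R]_n) : measurable A ->
  leb R n ((fun v => (-1) ^+ b *: v + y) @^-1` A) = leb R n A.
Proof.
elim: n y A => [|n IH] y A mA.
  by congr (leb R 0 _); apply/seteqP; split=> v /=; rewrite [_ + _]thinmx0 [v]thinmx0.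
have maff : measurable_fun setT (fun v : 'rV[R]_n.+1 => (-1) ^+ b *: v + y).
  apply: measurable_rVP => i; under eq_fun do rewrite !mxE.
  exact: (measurableT_comp (measurable_affine1 b (y ord0 i)) (measurable_coord i)).
have mA' : measurable ((fun v : 'rV[R]_n.+1 => (-1) ^+ b *: v + y) @^-1` A).
  by rewrite -[X in measurable X]setTI; exact: maff.
rewrite !lebS//.
rewrite -[RHS](integral_affine b (y ord0 ord0)); last 2 first.
- exact: measurable_leb_section.
- by move=> x; exact: measure_ge0.
apply: eq_integral => x _.
rewrite -[RHS](IH (@rsubmx _ 1 1 n y)); last exact: measurable_head_section.
congr (leb R n _); rewrite /head_section; apply/seteqP.
suff e v : (-1) ^+ b *: row_mx (x%:M : 'rV[R]_1) v + y =
  row_mx (((-1) ^+ b * x + y ord0 ord0)%:M : 'rV[R]_1) ((-1) ^+ b *: v + @rsubmx _ 1 1 n y).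
  by split=> v /=; rewrite e.
rewrite -{1}(@hsubmxK _ 1 1 n y) scale_row_mx add_row_mx; congr row_mx.
apply/rowP => i; rewrite !mxE (ord1 i) eqxx !mulr1n; congr (_ + y _ _).
exact: val_inj.
Qed.

End leb_theory.

(** * Volumes of cubes, and Tonelli for sets *)

Section leb_cubes.
Context (R : realType).

Lemma leb_cube n (c : 'rV[R]_n) (e : R) : 0 <= e ->
  leb R n (cube c e) = ((e *+ 2) ^+ n)%:E.
Proof.
move=> e0; elim: n c => [|n IH] c.
  rewrite lebE; last exact: measurable_cube.
  by rewrite /= indicE mem_set// => -[].
rewrite lebS; last exact: measurable_cube.
pose c' : 'rV[R]_n := \row_j c ord0 (lift ord0 j).
have secE x : head_section (cube c e) x =
    if x \in `]c ord0 ord0 - e, c ord0 ord0 + e[ then cube c' e else set0.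
  rewrite in_itv/= -ltr_distl; apply/seteqP; split=> [v h|v].
    have := h ord0; rewrite row_mx_head => ->.
    by move=> i; have := h (lift ord0 i); rewrite row_mx_tail !mxE.
  case: ifPn => // xc h i; case: (unliftP ord0 i) => [j|] ->.
    by rewrite row_mx_tail; have := h j; rewrite !mxE.
  by rewrite row_mx_head.
pose I : set R := `]c ord0 ord0 - e, c ord0 ord0 + e[%classic.
transitivity (\int[lebesgue_measure]_x (((e *+ 2) ^+ n)%:E * (\1_I x)%:E))%E.
  apply: eq_integral => x _; rewrite secE indicE mem_setE.
  by case: ifP => _; rewrite ?mule1 ?IH// measure0 mule0.
have mI : measurable_fun [set: R] (fun x : R => (\1_I x : R)%:E).
  by apply/measurable_EFinP; apply: measurable_indic; exact: measurable_itv.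
rewrite ge0_integralZl//; last by rewrite lee_fin exprn_ge0// mulrn_wge0.
have lI : lebesgue_measure I = (e *+ 2)%:E.
  rewrite /I lebesgue_measure_itv/= lte_fin; case: ifPn => [_|].
    by rewrite -EFinB; congr EFin; ring.
  by rewrite -leNgt => h; rewrite (_ : e = 0) ?mul0rn//; lra.
rewrite integral_indic//; last exact: measurable_itv.
transitivity (((e *+ 2) ^+ n)%:E * lebesgue_measure I)%E; first by rewrite setIT.
by rewrite lI -EFinM exprSr.
Qed.

Lemma measurable_rV1 n (x : 'rV[R]_n) : measurable [set x].
Proof.
have -> : [set x] = \bigcap_(i : 'I_n)
    ((fun y : 'rV[R]_n => y ord0 i) @^-1` [set x ord0 i]).
  apply/seteqP; split=> [_ -> //|y /= xy].
  by apply/rowP => i; exact: (xy i Logic.I).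
apply: fin_bigcap_measurable => // i _; rewrite -[X in measurable X]setTI.
exact: measurable_coord.
Qed.

Lemma leb_origin n : leb R n.+1 [set (0 : 'rV[R]_n.+1)] = 0%E.
Proof.
have le_e (e : R) : 0 < e -> (leb R n.+1 [set 0%R] <= ((e *+ 2) ^+ n.+1)%:E)%E.
  move=> e0; rewrite -(leb_cube (0 : 'rV[R]_n.+1)) ; last exact: ltW.
  apply: le_measure; rewrite ?inE.
  - exact: measurable_rV1.
  - exact: measurable_cube.
  by move=> _ -> i; rewrite subrr normr0.
apply/eqP; rewrite eq_le measure_ge0 andbT; apply/lee_addgt0Pr => e e0.
(* The cube then has side [min e 1]; as this is at most 1, its positive powers are at most [e]. *)
rewrite add0e; pose d := Num.min e 1 / 2.
have d0 : 0 < d by rewrite divr_gt0// lt_min e0 ltr01.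
apply: (le_trans (le_e _ d0)).
have -> : d *+ 2 = Num.min e 1 by rewrite /d; field.
rewrite lee_fin exprS -[leRHS]mulr1 ler_pM ?exprn_ge0 ?ge_min ?lexx//.
- by rewrite le_min ltW//= ler01.
- by rewrite le_min ltW//= ler01.
- by rewrite exprn_ile1 ?ge_min ?lexx ?orbT// le_min ltW//= ler01.
Qed.

Lemma tonelli_set d1 d2 (T1 : measurableType d1) (T2 : measurableType d2)
    (m1 : {sigma_finite_measure set T1 -> \bar R})
    (m2 : {sigma_finite_measure set T2 -> \bar R}) (E : set (T1 * T2)) :
  measurable E ->
  (\int[m1]_x m2 [set y | E (x, y)] = \int[m2]_y m1 [set x | E (x, y)])%E.
Proof.
move=> mE; have := indic_fubini_tonelli m1 m2 mE.
rewrite indic_fubini_tonelli_FE// indic_fubini_tonelli_GE//= => h.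
transitivity (\int[m1]_x m2 (xsection E x))%E.
  by apply: eq_integral => x _; rewrite xsectionE.
by rewrite [LHS]h; apply: eq_integral => y _; rewrite ysectionE.
Qed.

End leb_cubes.

(** * Euclidean norm and balls *)

Section euclidean_norm.
Context (R : realType).

Lemma enorm_ge0 n (x : 'rV[R]_n) : 0 <= enorm x.
Proof. exact: sqrtr_ge0. Qed.

Lemma sqr_enorm n (x : 'rV[R]_n) : enorm x ^+ 2 = \sum_i x ord0 i ^+ 2.
Proof. by rewrite sqr_sqrtr// sumr_ge0// => i _; exact: sqr_ge0. Qed.

Lemma mulmx_tr_enorm n (x : 'rV[R]_n) : x *m x^T = (enorm x ^+ 2)%:M.
Proof.
apply/rowP => i; rewrite (ord1 i) !mxE eqxx mulr1n sqr_enorm.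
by apply: eq_bigr => j _; rewrite mxE expr2.
Qed.

Lemma enorm_eq_sqr n m (x : 'rV[R]_n) (y : 'rV[R]_m) :
  (enorm x == enorm y) = (enorm x ^+ 2 == enorm y ^+ 2).
Proof. by rewrite eqrXn2// enorm_ge0. Qed.

Lemma enorm_mulmx n m (x : 'rV[R]_n) (U : 'M[R]_(n, m)) :
  U *m U^T = 1%:M -> enorm (x *m U) = enorm x.
Proof.
move=> UU; apply/eqP; rewrite enorm_eq_sqr -[_ == _]mulr1n; apply/eqP.
have := mulmx_tr_enorm (x *m U).
rewrite trmx_mul mulmxA -(mulmxA x) UU mulmx1 mulmx_tr_enorm => /rowP/(_ ord0).
by rewrite !mxE eqxx !mulr1n.
Qed.

Lemma enormZ n (a : R) (x : 'rV[R]_n) : enorm (a *: x) = `|a| * enorm x.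
Proof.
rewrite -sqrtr_sqr -sqrtrM ?sqr_ge0// mulr_sumr; congr Num.sqrt.
by apply: eq_bigr => i _; rewrite mxE exprMn.
Qed.

Lemma enorm0 n : enorm (0 : 'rV[R]_n) = 0.
Proof. by rewrite -[in LHS](scale0r 0) enormZ normr0 mul0r. Qed.

Lemma enorm_eq0 n (x : 'rV[R]_n) : (enorm x == 0) = (x == 0).
Proof.
apply/idP/eqP => [|->]; last by rewrite enorm0.
rewrite -sqrf_eq0 sqr_enorm psumr_eq0 => [/allP x0|i _]; last exact: sqr_ge0.
by apply/rowP => i; apply/eqP; have := x0 i (mem_index_enum _); rewrite sqrf_eq0 mxE.
Qed.

Lemma norm_coord_le n (x : 'rV[R]_n) i : `|x ord0 i| <= enorm x.
Proof.
rewrite -[leLHS]ger0_norm// -[leRHS]ger0_norm ?enorm_ge0// -ler_sqr ?nnegrE//.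
rewrite !normr_id real_normK ?num_real// [`|enorm x|]ger0_norm ?enorm_ge0// sqr_enorm.
by rewrite (bigD1 i)//= lerDl sumr_ge0// => j _; exact: sqr_ge0.
Qed.

Lemma measurable_enorm n : measurable_fun [set: 'rV[R]_n] (@enorm R n).
Proof.
apply: (@measurableT_comp _ _ _ _ _ _ (@Num.sqrt R)).
  by apply: continuous_measurable_fun; exact: sqrt_continuous.
apply: measurable_sum => i; apply: measurable_funX; exact: measurable_coord.
Qed.

Definition eball n (c : R) : set 'rV[R]_n := [set x | enorm x <= c].

Lemma measurable_eball n c : measurable (@eball n c).
Proof.
have -> : @eball n c = @enorm R n @^-1` `]-oo, c]%classic.
  by apply/seteqP; split=> x /=; rewrite in_itv/=.
by rewrite -[X in measurable X]setTI; apply: measurable_enorm => //; exact: measurable_itv.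
Qed.

Lemma leb_open_gt0 n (U : set 'rV[R]_n) : open U -> U !=set0 -> (0 < leb R n U)%E.
Proof.
move=> oU [x /(open_cubeP oU)[e e0 xU]].
apply: (@lt_le_trans _ _ (leb R n (cube x e))).
  by rewrite leb_cube ?(ltW e0)// lte_fin exprn_gt0// pmulrn_lgt0.
by apply: le_measure; rewrite ?inE//; [exact: measurable_cube|exact: open_measurable_rV].
Qed.

Lemma eball_fin n c : (leb R n (eball c) < +oo)%E.
Proof.
apply: (@le_lt_trans _ _ (leb R n (cube 0 (`|c| + 1)))).
  apply: le_measure; rewrite ?inE; [exact: measurable_eball|exact: measurable_cube|].
  move=> x xc i; rewrite mxE subr0 (le_lt_trans (norm_coord_le x i))//.
  by rewrite (le_lt_trans xc)// ltr_pwDr// ler_norm.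
by rewrite leb_cube ?ltry// addr_ge0.
Qed.

Lemma eball_gt0 n c : 0 < c -> (0 < leb R n (eball c))%E.
Proof.
(* A point of the cube of half-side [e] has squared norm at most [n * e^2 <= c^2], because
   [n <= (n + 1)^2]. *)
move=> c0; pose e := c / n.+1%:R.
have e0 : 0 < e by rewrite divr_gt0.
apply: (@lt_le_trans _ _ (leb R n (cube 0 e))).
  by rewrite leb_cube ?(ltW e0)// lte_fin exprn_gt0// pmulrn_lgt0.
apply: le_measure; rewrite ?inE; [exact: measurable_cube|exact: measurable_eball|].
move=> x xe; rewrite /eball/= -ler_sqr ?nnegrE ?enorm_ge0 ?(ltW c0)// sqr_enorm.
apply: (@le_trans _ _ (\sum_(i < n) e ^+ 2)).
  apply: ler_sum => i _; rewrite -[x _ _ ^+ 2]real_normK ?num_real//.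
  by rewrite ler_sqr ?nnegrE ?(ltW e0)// ltW//; have := xe i; rewrite mxE subr0.
rewrite sumr_const card_ord /e exprMn -[leLHS]mulr_natl mulrCA ler_piMr ?sqr_ge0//.
rewrite exprVn ler_pdivrMr ?exprn_gt0// mul1r -natrX ler_nat.
by rewrite (leq_trans (leqnSn n))// expnS expn1 leq_pmulr.
Qed.

End euclidean_norm.

(** * Invariance of Lebesgue measure under linear isometries *)

Lemma integral_if d (T : measurableType d) (R : realType)
    (m : {measure set T -> \bar R}) (C : set T) (k : \bar R) :
  measurable C -> (0 <= k)%E ->
  (\int[m]_x (if `[< C x >] then k else 0) = m C * k)%E.
Proof.
move=> mC k0; rewrite muleC -integral_cst// [RHS]integral_mkcond.
by apply: eq_integral => x _; rewrite patchE.
Qed.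

Section isometry.
Context (R : realType) (n : nat).
Local Notation V := 'rV[R]_n.

Lemma measurable_addV : measurable_fun [set: V * V] (fun p => p.1 + p.2).
Proof.
apply: measurable_rVP => i; under eq_fun do rewrite mxE.
by apply: measurable_funD; apply: (measurableT_comp (measurable_coord i)).
Qed.

(* Exchanging the order of integration in the set of (x, y) with A x and
   B (x + y) shows that mu A * leb B = mu B * leb A: translate in y, then in x. *)
Lemma translation_invariant_unique (mu : {sigma_finite_measure set V -> \bar R})
    (muD : forall (y : V) (A : set V),
       measurable A -> mu [set x | A (x + y)] = mu A)
    (A B : set V) :
  measurable A -> measurable B -> (mu A * leb R n B = mu B * leb R n A)%E.
Proof.
move=> mA mB.
have mpre (f : V * V -> V) C : measurable_fun setT f -> measurable C ->
    measurable (f @^-1` C).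
  by move=> mf mC; rewrite -[X in measurable X]setTI; exact: mf.
pose E (p : V * V) := A p.1 /\ B (p.1 + p.2).
have mE : measurable E.
  apply: measurableI; last exact: mpre measurable_addV mB.
  exact: mpre measurable_fst mA.
pose E' (p : V * V) := A (p.1 - p.2) /\ B p.1.
have mE' : measurable E'.
  apply: measurableI; last exact: mpre measurable_fst mB.
  apply: mpre mA; apply: measurable_rVP => i; under eq_fun do rewrite !mxE.
  by apply: measurable_funB; apply: (measurableT_comp (measurable_coord i)).
transitivity (\int[mu]_x leb R n [set y | E (x, y)])%E.
  rewrite -integral_if//; apply: eq_integral => x _; case: asboolP => Ax.
    rewrite -(leb_affine false x mB); congr (leb R n _).
    by apply/seteqP; split=> y /=; rewrite /E/= expr0 scale1r addrC; tauto.
  rewrite (_ : [set y | _] = set0) ?measure0//.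
  by apply/seteqP; split=> y //= -[].
rewrite (tonelli_set _ _ mE).
transitivity (\int[leb R n]_y mu [set x | E' (x, y)])%E.
  apply: eq_integral => y _.
  rewrite -(muD y [set x | E' (x, y)]).
    congr (mu _); apply/seteqP; split=> x /=; rewrite /E /E'/= addrK; tauto.
  have -> : [set x | E' (x, y)] = ysection E' y by rewrite ysectionE.
  exact: measurable_ysection.
rewrite -(tonelli_set _ _ mE') -integral_if//; apply: eq_integral => x _.
case: asboolP => Bx.
  rewrite -(leb_affine true x mA); congr (leb R n _).
  by apply/seteqP; split=> y /=; rewrite /E'/= expr1 scaleN1r addrC; tauto.
rewrite (_ : [set y | _] = set0) ?measure0//.
by apply/seteqP; split=> y //= -[].
Qed.

(** The pushforward of [leb] by [f] is translation invariant, hence proportional to [leb]. The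
    factor is 1, since [f] preserves the unit ball, whose volume is positive and finite. *)
Lemma leb_isometry (f g : V -> V) (A : set V) :
    measurable_fun setT f -> measurable_fun setT g -> cancel f g -> cancel g f ->
    {morph f : x y / x + y} -> (forall x, enorm (f x) = enorm x) ->
  measurable A -> leb R n (f @^-1` A) = leb R n A.
Proof.
move=> mf mg fK gK fD fn mA.
have [mu muE] := sigma_finite_pushforward mf mg fK (sigma_finiteT (leb R n)).
have mpre C : measurable C -> measurable (f @^-1` C).
  by move=> mC; rewrite -[X in measurable X]setTI; exact: mf.
have muD (y : V) (B : set V) : measurable B -> mu [set x | B (x + y)] = mu B.
  (* By additivity, translating by [y] after [f] amounts to translating by [g y] before it. *)
  move=> mB; rewrite muE /pushforward -(leb_affine false (g y) (mpre _ mB)).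
  congr (leb R n _); apply/seteqP; split=> x /=; by rewrite expr0 scale1r fD gK.
have := translation_invariant_unique muD mA (measurable_eball (n:=n) (1 : R)).
have -> : mu (eball 1) = leb R n (eball 1).
  by rewrite muE; congr (leb R n _); apply/seteqP; split=> x; rewrite /eball/= fn.
rewrite muE /pushforward muleC => /eqP.
have ball_fin : leb R n (eball 1) \is a fin_num.
  by rewrite ge0_fin_numE ?measure_ge0// eball_fin.
rewrite eq_le !lee_pmul2l ?eball_gt0// => h; apply/eqP.
by rewrite eq_le.
Qed.

End isometry.

(** * Arcs in digraphs without directed triangles *)

Section triangle_free_digraph.
Context (T : finType) (e : rel T).
Hypothesis no_triangle : forall x y z, ~~ [&& e x y, e y z & e z x].

Definition arcs (A : {set T}) : nat := (\sum_(x in A) \sum_(y in A) e x y)%N.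

(** Taking [x = y = z] in [no_triangle] excludes loops, so deleting [u] loses only the arcs joining
    it to other vertices. *)
Lemma arcs_setD1 (A : {set T}) u : u \in A ->
  arcs A = (arcs (A :\ u) + \sum_(x in A :\ u) (e x u + e u x))%N.
Proof.
move=> uA.
have uu : e u u = false by have := no_triangle u u u; rewrite !andbb => /negbTE.
rewrite /arcs (big_setD1 u uA)/= (big_setD1 u uA)/= uu add0n.
under [X in (_ + X)%N]eq_bigr do rewrite (big_setD1 u uA).
by rewrite !big_split/=; lia.
Qed.

(** Strong induction on the number of vertices. If two vertices are joined both ways, delete both;
    otherwise each pair carries at most one arc, and [m (m - 1) / 2] suffices. *)
Lemma arcs_le (A : {set T}) : (arcs A <= (#|A| ^ 2)./2)%N.
Proof.
have [k] := ubnP #|A|; elim: k A => // k IH A Ak.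
have [|nbi] := boolP [exists u in A, [exists v in A, e u v && e v u]].
  move=> /exists_inP[u uA /exists_inP[v vA /andP[uv vu]]].
  have vu' : v \in A :\ u.
    rewrite !inE vA andbT; apply/eqP => vuE; subst v.
    by have := no_triangle u u u; rewrite uv.
  rewrite (arcs_setD1 uA) (arcs_setD1 vu') (big_setD1 v vu')/= uv vu.
  set B := A :\ u :\ v.
  have cA : #|A| = #|B|.+2 by rewrite (cardsD1 u A) uA (cardsD1 v (A :\ u)) vu'.
  (* For each [x], a path from [v] to [u] through [x] would close with the arc from [u] to [v], and
     symmetrically. So at most one arc survives in each of the pairs ([e v x], [e x u]) and
     ([e u x], [e x v]). *)
  have le2 : (\sum_(x in B) (e x v + e v x) + \sum_(x in B) (e x u + e u x) <= 2 * #|B|)%N.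
    rewrite -big_split/= mulnC -sum_nat_const; apply: leq_sum => x _.
    have := no_triangle u v x; have := no_triangle v u x; rewrite uv vu/=.
    by case: (e x v); case: (e v x); case: (e x u); case: (e u x).
  have h : (arcs B <= (#|B| ^ 2)./2)%N by apply: IH; lia.
  rewrite cA.
  have -> : ((#|B|.+2 ^ 2)./2 = (#|B| ^ 2)./2 + 2 * #|B| + 2)%N by nia.
  lia.
have le1 x y : x \in A -> y \in A -> (e x y + e y x <= (x != y))%N.
  move=> xA yA; case: eqVneq => [<-|_].
    by have := no_triangle x x x; rewrite !andbb => /negbTE ->.
  apply: contraT; rewrite -ltnNge => h; case/negP: nbi.
  apply/exists_inP; exists x => //; apply/exists_inP; exists y => //.
  by move: h; case: (e x y); case: (e y x).
have : (arcs A + arcs A <= #|A| * #|A|.-1)%N.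
  rewrite {2}/arcs exchange_big/= -big_split/= -sum_nat_const; apply: leq_sum => x xA.
  rewrite -big_split/=; apply: (@leq_trans (\sum_(y in A) (x != y))).
    by apply: leq_sum => y yA; exact: le1.
  rewrite (big_setD1 x xA)/= eqxx add0n (cardsD1 x A) xA/= -sum1_card.
  by apply: leq_sum => y _; case: (x != y).
nia.
Qed.
End triangle_free_digraph.

(** * Orthogonal matrices, Gram-Schmidt and the regular simplex *)

Section orthogonal.
Context (R : realType).

(** For [v != w], the witness is the Householder reflection in the hyperplane orthogonal to
    [v - w]. *)
Lemma orthogonal_transitive n (v w : 'rV[R]_n) : enorm v = 1 -> enorm w = 1 ->
  exists2 H : 'M[R]_n, H *m H^T = 1%:M & v *m H = w.
Proof.
move=> v1 w1; have [<-|vw] := eqVneq v w.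
  by exists 1%:M; rewrite ?trmx1 mulmx1.
pose u := v - w; pose N := enorm u ^+ 2; pose c := 2 / N.
have N0 : N != 0 by rewrite sqrf_eq0 enorm_eq0 subr_eq0.
have uu : u *m u^T = N%:M by exact: mulmx_tr_enorm.
have vv : v *m v^T = 1%:M by rewrite mulmx_tr_enorm v1 expr1n.
have ww : w *m w^T = 1%:M by rewrite mulmx_tr_enorm w1 expr1n.
have vwC : w *m v^T = v *m w^T.
  by apply/rowP => i; rewrite !mxE; apply: eq_bigr => j _; rewrite !mxE mulrC (ord1 i).
(* Both vectors are unit, so [N = 2 - 2 (v . w) = 2 (v . u)]. *)
have vu : v *m u^T = (N / 2)%:M.
  have : N%:M = (2 : R) *: (v *m u^T).
    rewrite -uu {1}/u mulmxBl.
    have -> : v *m u^T = 1%:M - v *m w^T by rewrite /u linearB/= mulmxBr vv.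
    have -> : w *m u^T = v *m w^T - 1%:M by rewrite /u linearB/= mulmxBr ww vwC.
    by rewrite scaler_nat mulr2n opprB.
  move=> h; rewrite mulrC -scale_scalar_mx h scalerA mulVf ?scale1r// pnatr_eq0.
have HT : (1%:M - c *: (u^T *m u))^T = 1%:M - c *: (u^T *m u).
  by rewrite linearB/= trmx1 linearZ/= trmx_mul trmxK.
exists (1%:M - c *: (u^T *m u)).
  rewrite HT mulmxBr mulmx1 mulmxBl mul1mx.
  rewrite -scalemxAl -scalemxAr -mulmxA (mulmxA u) uu mul_scalar_mx -scalemxAr.
  rewrite !scalerA (_ : c * (c * N) = c + c) ?scalerDl; last by rewrite /c; field.
  by rewrite opprB addrK subrK.
rewrite mulmxBr mulmx1 -scalemxAr mulmxA vu mul_scalar_mx scalerA.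
by rewrite (_ : c * _ = 1) ?scale1r ?/u ?subKr// /c; field.
Qed.

(** Rows are treated from the bottom up. A row depending on those below leaves a zero residual and
    yields a zero row, so the map is total. *)
Fixpoint gram_schmidt d n : 'M[R]_(n, d) -> 'M[R]_(n, d) :=
  match n with
  | 0 => id
  | m.+1 => fun A : 'M[R]_(1 + m, d) =>
      let Q := gram_schmidt (dsubmx A) in
      let r := usubmx A - usubmx A *m Q^T *m Q in
      col_mx ((enorm r)^-1 *: r) Q
  end.

(** The construction uses only inner products and norms of rows, which [U] preserves. *)
Lemma gram_schmidt_mulmx d n (A : 'M[R]_(n, d)) (U : 'M[R]_d) :
  U *m U^T = 1%:M -> gram_schmidt (A *m U) = gram_schmidt A *m U.
Proof.
move=> UU; elim: n A => [|n IH] A //=.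
rewrite -mul_usub_mx -mul_dsub_mx IH [RHS](mul_col_mx (m1 := 1)).
apply: (f_equal2 (@col_mx R 1 n d)) => //.
set Q := gram_schmidt _; set a := usubmx _.
rewrite trmx_mul !mulmxA -(mulmxA a) UU mulmx1 -mulmxBl enorm_mulmx//.
by rewrite -scalemxAl.
Qed.

Lemma gram_schmidt_orthogonal d n (A : 'M[R]_(n, d)) : row_free A ->
  gram_schmidt A *m (gram_schmidt A)^T = 1%:M.
Proof.
(* The induction also carries the inclusion of row spaces, used to show that the residual of the top
   row is nonzero. *)
suff h : row_free A -> gram_schmidt A *m (gram_schmidt A)^T = 1%:M /\
    (gram_schmidt A <= A)%MS by move=> /h[].
elim: n A => [|n IH] A rA.
  by split; [apply/matrixP => -[]|rewrite [A]flatmx0 submx_refl].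
pose a := @usubmx R 1 n d A; pose A' := @dsubmx R 1 n d A.
have AE : A = col_mx a A' by rewrite (@vsubmxK R 1 n d).
have rkA : \rank (a + A')%MS = n.+1 by rewrite addsmxE -AE; exact/eqP.
have rA' : row_free A'.
  have := (mxrank_adds_leqif a A').1; have := rank_leq_row a.
  have := rank_leq_row A'; rewrite rkA /row_free => ? ? ?; apply/eqP; lia.
have [QQ QA] := IH _ rA'.
pose Q := gram_schmidt A'; rewrite -/Q in QQ QA.
pose r := a - a *m Q^T *m Q.
have gsE : gram_schmidt A = col_mx ((enorm r)^-1 *: r) Q by [].
have r0 : enorm r != 0.
  (* A zero residual would put the top row in the span of the others, against the rank of [A]. *)
  rewrite enorm_eq0 subr_eq0; apply/eqP => aE.
  have aA' : (a <= A')%MS by rewrite aE (submx_trans (submxMl _ _)).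
  have : (a + A' <= A')%MS by rewrite addsmx_sub aA' submx_refl.
  by move=> /mxrankS; rewrite rkA; have := rank_leq_row A'; lia.
have rQ : r *m Q^T = 0 by rewrite mulmxBl -!mulmxA QQ mulmx1 subrr.
have Qr : Q *m r^T = 0 by rewrite -[LHS]trmxK trmx_mul trmxK rQ trmx0.
rewrite gsE; split.
  set q := _ *: r; rewrite -[LHS]/(col_mx q Q *m (col_mx q Q)^T) /q.
  rewrite tr_col_mx mul_col_row linearZ/= -!scalemxAl -!scalemxAr rQ Qr QQ.
  rewrite !scaler0 mulmx_tr_enorm !scale_scalar_mx mulrA -expr2 -exprMn.
  by rewrite mulVf// expr1n -scalar_mx_block.
have QaA' : (Q <= a + A')%MS by rewrite (submx_trans QA)// addsmxSr.
have qQ : (col_mx ((enorm r)^-1 *: r) Q <= a + A')%MS.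
  rewrite col_mx_sub QaA' andbT scalemx_sub// addmx_sub ?addsmxSl// eqmx_opp.
  by rewrite (submx_trans (submxMl _ _)).
by apply: (submx_trans qQ); rewrite AE addsmxE.
Qed.

(* The vertices are the rescaled basis vectors and a multiple t of (1, ..., 1),
   with t solving n t^2 - 2 a t + a^2 = 1 where a^2 = 1/2. *)
Lemma regular_simplex n : (0 < n)%N -> exists u : 'I_n.+1 -> 'rV[R]_n,
  forall i j, i != j -> enorm (u i - u j) = 1.
Proof.
move=> n0; pose a : R := Num.sqrt (1 / 2); pose s : R := Num.sqrt ((1 + n%:R) / 2).
have a2 : a ^+ 2 = 1 / 2 by rewrite sqr_sqrtr// divr_ge0.
have s2 : s ^+ 2 = (1 + n%:R) / 2 by rewrite sqr_sqrtr// divr_ge0 ?addr_ge0.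
have nR0 : n%:R != 0 :> R by rewrite pnatr_eq0 -lt0n.
pose t : R := (a + s) / n%:R.
pose u (i : 'I_n.+1) : 'rV[R]_n :=
  if unlift ord_max i is Some k then a *: delta_mx 0 k else const_mx t.
have enormN (x y : 'rV[R]_n) : enorm (x - y) = enorm (y - x).
  by rewrite -opprB -scaleN1r enormZ normrN1 mul1r.
have norm1 (x : 'rV[R]_n) : enorm x ^+ 2 = 1 -> enorm x = 1.
  by move=> h; apply/eqP; rewrite -(eqrXn2 (n := 2)) ?enorm_ge0// h expr1n.
have top k : enorm (const_mx t - a *: delta_mx 0 k : 'rV[R]_n) = 1.
  apply: norm1; rewrite sqr_enorm (bigD1 k)//= !mxE !eqxx mulr1.
  under eq_bigr => j /negbTE jk do rewrite !mxE jk andbF mulr0 subr0.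
  rewrite sumr_const cardC1 card_ord -mulr_natl -subn1 natrB//.
  have -> : (t - a) ^+ 2 + (n%:R - 1) * t ^+ 2 = (s ^+ 2 - a ^+ 2) / n%:R + a ^+ 2.
    by rewrite /t; field.
  by rewrite s2 a2; field.
exists u => i j; rewrite /u; case: unliftP => [k|] ->; case: unliftP => [l|] ->.
- rewrite (inj_eq lift_inj) => kl; apply: norm1.
  rewrite sqr_enorm (bigD1 k)//= (bigD1 l) 1?eq_sym//= !mxE !eqxx.
  rewrite (eq_sym l k) (negbTE kl) !andbF mulr0 mulr1 subr0 sub0r sqrrN a2.
  rewrite big1 => [|m /andP[/negbTE mk /negbTE ml]]; first by field.
  by rewrite !mxE mk ml !andbF mulr0 subr0 expr0n.
- by rewrite enormN.
- by [].
- by rewrite eqxx.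
Qed.

End orthogonal.

(** * Measurability of matrix-valued maps *)

Section measurable_matrix.
Context d (T : measurableType d) (R : realType).

(** Working entrywise avoids fixing a sigma-algebra on matrices; for rows both notions agree by
    [mx_measurable_row]. *)
Definition mx_measurable m n (A : T -> 'M[R]_(m, n)) :=
  forall i j, measurable_fun [set: T] (fun t => A t i j).

Lemma mx_measurable_mul m n p (A : T -> 'M[R]_(m, n)) (B : T -> 'M[R]_(n, p)) :
  mx_measurable A -> mx_measurable B -> mx_measurable (fun t => A t *m B t).
Proof.
move=> mA mB i j; under eq_fun do rewrite mxE.
by apply: measurable_sum => k; apply: measurable_funM.
Qed.

Lemma mx_measurable_tr m n (A : T -> 'M[R]_(m, n)) :
  mx_measurable A -> mx_measurable (fun t => (A t)^T).
Proof. by move=> mA i j; under eq_fun do rewrite mxE; exact: mA. Qed.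

Lemma mx_measurable_scale m n (a : T -> R) (A : T -> 'M[R]_(m, n)) :
  measurable_fun [set: T] a -> mx_measurable A -> mx_measurable (fun t => a t *: A t).
Proof. by move=> ma mA i j; under eq_fun do rewrite mxE; exact: measurable_funM. Qed.

Lemma mx_measurable_row n (A : T -> 'rV[R]_n) :
  mx_measurable A <-> measurable_fun [set: T] A.
Proof.
split=> [mA|mA i j]; first by apply: measurable_rVP => i; exact: mA.
rewrite (ord1 i); exact: (measurableT_comp (measurable_coord j) mA).
Qed.

Lemma measurable_enormV n (A : T -> 'rV[R]_n) :
  mx_measurable A -> measurable_fun [set: T] (fun t => (enorm (A t))^-1).
Proof.
move=> /mx_measurable_row mA.
(* On nonnegative reals, 0 included, the inverse is the power -1, whose measurability is known. *)
under eq_fun do rewrite -powR_inv1 ?enorm_ge0//.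
apply: (@measurableT_comp _ _ _ _ _ _ (fun x : R => x `^ (-1)) _ (fun t => enorm (A t))).
  exact: measurable_powR.
exact: (measurableT_comp (measurable_enorm (n:=n)) mA).
Qed.

Lemma mx_measurable_gram_schmidt m n (A : T -> 'M[R]_(m, n)) :
  mx_measurable A -> mx_measurable (fun t => gram_schmidt (A t)).
Proof.
elim: m A => [|m IH] A mA; first by case.
have mu : mx_measurable (fun t => @usubmx R 1 m n (A t)).
  by move=> i j; under eq_fun do rewrite mxE; exact: mA.
have mQ : mx_measurable (fun t => gram_schmidt (@dsubmx R 1 m n (A t))).
  by apply: IH => i j; under eq_fun do rewrite mxE; exact: mA.
have mr : mx_measurable (fun t => @usubmx R 1 m n (A t) -
    @usubmx R 1 m n (A t) *m (gram_schmidt (@dsubmx R 1 m n (A t)))^T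
      *m gram_schmidt (@dsubmx R 1 m n (A t))).
  move=> i j; under eq_fun do rewrite mxE [X in _ + X]mxE.
  apply: measurable_funB; first exact: mu.
  apply: mx_measurable_mul => //; apply: mx_measurable_mul => //.
  exact: mx_measurable_tr.
move=> i j; case: (@split_ordP 1 m i) => k ->.
  under eq_fun do rewrite [gram_schmidt _ _ _](@col_mxEu R 1 m n).
  by apply: mx_measurable_scale => //; exact: measurable_enormV.
under eq_fun do rewrite [gram_schmidt _ _ _](@col_mxEd R 1 m n).
exact: mQ.
Qed.

Lemma measurable_mx_eq m n (A B : T -> 'M[R]_(m, n)) :
  mx_measurable A -> mx_measurable B -> measurable [set t | A t = B t].
Proof.
move=> mA mB.
have -> : [set t | A t = B t] = \bigcap_(p : 'I_m * 'I_n)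
    ((fun t => A t p.1 p.2 - B t p.1 p.2) @^-1` [set 0]).
  apply/seteqP; split=> [t /= AB p _ /=|t AB]; first by rewrite AB subrr.
  by apply/matrixP => i j; apply/eqP; rewrite -subr_eq0; apply/eqP; exact: (AB (i, j)).
apply: fin_bigcap_measurable => // p _; rewrite -[X in measurable X]setTI.
exact: measurable_funB.
Qed.
End measurable_matrix.

(** * The random orthonormal frame *)

Section random_frame.
Context (R : realType) (n : nat).
Local Notation V := 'rV[R]_n.
Local Notation W := 'rV[R]_(n * n).

Definition frame (w : W) : 'M[R]_n := gram_schmidt (vec_mx w).

(** The sample space, with Lebesgue measure left unnormalized. Matrices are flattened to rows of
    length [n * n] so that [leb] applies. *)
Definition frames (c : R) : set W :=
  [set w | enorm w <= c /\ frame w *m (frame w)^T = 1%:M].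

Lemma mx_measurable_frame d (T : measurableType d) (w : T -> W) :
  measurable_fun setT w -> mx_measurable (fun t => frame (w t)).
Proof.
move=> mw; apply: mx_measurable_gram_schmidt => i j; under eq_fun do rewrite mxE.
exact: (measurableT_comp (measurable_coord _) mw).
Qed.

Lemma measurable_frames c : measurable (frames c).
Proof.
have mf := mx_measurable_frame (@measurable_id _ W setT).
apply: measurableI; first exact: measurable_eball.
apply: measurable_mx_eq; last by move=> i j; exact: measurable_cst.
by apply: mx_measurable_mul => //; exact: mx_measurable_tr.
Qed.

Lemma frames_fin c : (leb R (n * n) (frames c) < +oo)%E.
Proof.
apply: le_lt_trans (eball_fin (n * n) c); apply: le_measure; rewrite ?inE.
- exact: measurable_frames.
- exact: measurable_eball.
- by move=> w [].
Qed.

(** This Frobenius form shows that right multiplication by an orthogonal matrix is a Euclidean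
    isometry of the flattened matrices. *)
Lemma sqr_enorm_mxvec (A : 'M[R]_n) : enorm (mxvec A) ^+ 2 = \tr (A *m A^T).
Proof.
rewrite sqr_enorm (reindex _ (curry_mxvec_bij _ _))/=.
rewrite (eq_bigr (fun p : 'I_n * 'I_n => A p.1 p.2 ^+ 2)); last by case=> i j _; rewrite mxvecE.
rewrite -(pair_bigA _ (fun i j => A i j ^+ 2))/=; apply: eq_bigr => i _.
by rewrite mxE; apply: eq_bigr => j _; rewrite mxE expr2.
Qed.

(** The invertible matrices of norm less than [c] form an open set contained in [frames c]; this [c]
    exceeds the norm of the identity, so that set is nonempty. *)
Lemma frames_gt0 : exists c, (0 < leb R (n * n) (frames c))%E.
Proof.
pose c := enorm (mxvec 1%:M : W) + 1; exists c.
pose U : set W := [set w | enorm w < c /\ \det (vec_mx w) != 0].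
have cont_coord k : continuous (fun w : W => w ord0 k) by exact: coord_continuous.
have cont_enorm : continuous (@enorm R (n * n)).
  have cs : continuous (fun x : W => \sum_i x ord0 i ^+ 2).
    apply: (@continuous_big R 'I_(n * n) +%R 0 xpredT (@add_continuous R)).
    move=> k _ x; apply: (@continuous_comp _ _ _ (fun y : W => y ord0 k) (fun z : R => z ^+ 2)).
      exact: cont_coord.
    exact: exprn_continuous.
  by move=> w; apply: (continuous_comp (cs w)); exact: sqrt_continuous.
have cont_det : continuous (fun w : W => \det (vec_mx w)).
  apply: (@continuous_big R _ +%R 0 xpredT (@add_continuous R)) => s _ x.
  have cp : continuous (fun w : W => \prod_i vec_mx w i ((s : 'S_n) i)).
    apply: (@continuous_big R _ *%R 1 xpredT (@mul_continuous R)) => k _.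
    under eq_fun do rewrite mxE; exact: cont_coord.
  by apply: cvgMl_tmp; [exact: (nbhs_filter x)|exact: (cp x)].
have oU : open U.
  have o1 : open (@enorm R (n * n) @^-1` [set y : R | y < c]).
    by apply: open_comp => [w _|]; [exact: cont_enorm|exact: open_lt].
  have o2 : open ((fun w : W => \det (vec_mx w)) @^-1` [set y : R | y != 0]).
    by apply: open_comp => [w _|]; [exact: cont_det|exact: open_neq].
  exact: (openI o1 o2).
apply: (@lt_le_trans _ _ (leb R (n * n) U)).
  apply: leb_open_gt0 => //; exists (mxvec 1%:M); split; first by rewrite ltrDl.
  by rewrite mxvecK det1 oner_neq0.
apply: le_measure; rewrite ?inE; [exact: open_measurable_rV|exact: measurable_frames|].
move=> w [/ltW wc dw]; split=> //; apply: gram_schmidt_orthogonal.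
by rewrite row_free_unit unitmxE unitfE.
Qed.

Lemma isometry_mulmx (Q : 'M[R]_n) (A : set V) : Q *m Q^T = 1%:M -> measurable A ->
  leb R n [set x | A (x *m Q)] = leb R n A.
Proof.
move=> QQ mA.
have mmul (P : 'M[R]_n) : measurable_fun setT (fun x : V => x *m P).
  apply/mx_measurable_row/mx_measurable_mul; first exact/mx_measurable_row/measurable_id.
  by move=> i j; exact: measurable_cst.
apply: (@leb_isometry R n (mulmx^~ Q) (mulmx^~ Q^T)) => //.
- by move=> x; rewrite -mulmxA QQ mulmx1.
- by move=> x; rewrite -mulmxA (mulmx1C QQ) mulmx1.
- by move=> x y; rewrite mulmxDl.
- by move=> x; rewrite enorm_mulmx.
Qed.

Variables (S : set V) (mS : measurable S) (c : R).

(** The transpose makes right multiplication act on [v]: replacing the frame [Q] by [Q *m P] turns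
    [v *m Q^T] into [(v *m P^T) *m Q^T]. *)
Definition hits (v : V) : set W := [set w | frames c w /\ S (v *m (frame w)^T)].

Lemma measurable_hits v : measurable (hits v).
Proof.
apply: measurableI; first exact: measurable_frames.
rewrite -[X in measurable X]setTI; apply: (_ : measurable_fun setT _) => //.
apply/mx_measurable_row/mx_measurable_mul; first by move=> i j; exact: measurable_cst.
by apply: mx_measurable_tr; apply: mx_measurable_frame; exact: measurable_id.
Qed.

(* The law of the random frame is invariant under right multiplication by an
   orthogonal matrix, as Gram-Schmidt commutes with it. *)
Lemma leb_hits_const v v' : enorm v = 1 -> enorm v' = 1 ->
  leb R (n * n) (hits v) = leb R (n * n) (hits v').
Proof.
move=> v1 v'1; have [H HH vH] := orthogonal_transitive v'1 v1.
have HTH : H^T *m H = 1%:M by exact: mulmx1C.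
pose phi (P : 'M[R]_n) (w : W) : W := mxvec (vec_mx w *m P).
have phiK (P Q : 'M[R]_n) : P *m Q = 1%:M -> cancel (phi P) (phi Q).
  by move=> PQ w; rewrite /phi mxvecK -mulmxA PQ mulmx1 vec_mxK.
have mphi P : measurable_fun setT (phi P).
  apply: measurable_rVP => k; case/mxvec_indexP: k => i j.
  under eq_fun do rewrite mxvecE.
  apply: mx_measurable_mul => {i j} i j; last exact: measurable_cst.
  by under eq_fun do rewrite mxE; exact: measurable_coord.
have normphi w : enorm (phi H^T w) = enorm w.
  apply/eqP; rewrite enorm_eq_sqr; apply/eqP.
  rewrite sqr_enorm_mxvec -[w in RHS]vec_mxK sqr_enorm_mxvec.
  by rewrite trmx_mul trmxK mulmxA -(mulmxA _ _ H) HTH mulmx1.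
have frame_phi w : frame (phi H^T w) = frame w *m H^T.
  by rewrite /frame mxvecK gram_schmidt_mulmx// trmxK.
transitivity (leb R (n * n) (phi H^T @^-1` hits v')).
  congr (leb R _ _); apply/seteqP.
  have e w : hits v w <-> hits v' (phi H^T w).
    rewrite /hits/= /frames/= normphi frame_phi trmx_mul trmxK !mulmxA vH.
    by rewrite -(mulmxA _ _ H) HTH mulmx1.
  by split=> w /e.
apply: (leb_isometry (g := phi H)) => //; last exact: measurable_hits.
- exact: phiK.
- exact: phiK.
- by move=> x y; rewrite /phi !linearD/= mulmxDl linearD.
Qed.

End random_frame.

(** * Averaging over frames *)

Section averaging.
Context (R : realType) (n : nat) (S : set 'rV[R]_n).
Hypothesis mS : measurable S.
Local Notation V := 'rV[R]_n.
Local Notation W := 'rV[R]_(n * n).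

(** The origin is left out so that every point can be scaled to a unit vector. *)
Definition punctured_ball : set V := [set x | 0 < enorm x <= 1].

Definition punctured_cone : set V :=
  [set x | punctured_ball x /\ S ((enorm x)^-1 *: x)].

Lemma measurable_punctured_ball : measurable punctured_ball.
Proof.
have -> : punctured_ball = @enorm R n @^-1` `]0, 1]%classic.
  by apply/seteqP; split=> x /=; rewrite in_itv.
by rewrite -[X in measurable X]setTI; apply: measurable_enorm => //; exact: measurable_itv.
Qed.

Lemma measurable_punctured_cone : measurable punctured_cone.
Proof.
apply: measurableI; first exact: measurable_punctured_ball.
rewrite -[X in measurable X]setTI; apply: (_ : measurable_fun setT _) => //.
have mid := (mx_measurable_row _).2 (@measurable_id _ V setT).
apply/mx_measurable_row/mx_measurable_scale; last exact: mid.
exact: measurable_enormV.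
Qed.

(** Double counting of the pairs [(x, w)] for which the frame of [w] sends the direction of [x] into
    [S]. For fixed [x] the measure is that of [hits S c v]; for fixed [w] it is that of the
    punctured cone, by isometry. *)
Lemma leb_hits_cone c v : enorm v = 1 ->
  (leb R n punctured_ball * leb R (n * n) (hits S c v) =
   leb R (n * n) (@frames R n c) * leb R n punctured_cone)%E.
Proof.
move=> v1.
pose E (p : V * W) := punctured_ball p.1 /\
  hits S c ((enorm p.1)^-1 *: p.1) p.2.
have mE : measurable E.
  have mpre d (T T' : measurableType d) (f : V * W -> T) C :
    measurable_fun setT f -> measurable C -> measurable (f @^-1` C).
    by move=> mf mC; rewrite -[X in measurable X]setTI; exact: mf.
  apply: measurableI; first by apply: (mpre _ _ V fst) => //; exact: measurable_punctured_ball.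
  apply: measurableI; first by apply: (mpre _ _ W snd) => //; exact: measurable_frames.
  apply: (mpre _ _ V (fun p => ((enorm p.1)^-1 *: p.1) *m (frame p.2)^T)) => //.
  have m1 : mx_measurable (fun p : V * W => p.1).
    by apply/mx_measurable_row; exact: measurable_fst.
  apply/mx_measurable_row/mx_measurable_mul.
    by apply: mx_measurable_scale => //; exact: measurable_enormV.
  by apply: mx_measurable_tr; apply: mx_measurable_frame; exact: measurable_snd.
have := tonelli_set (leb R n) (leb R (n * n)) mE.
have -> : (\int[leb R n]_x leb R (n * n) [set w | E (x, w)] =
    leb R n punctured_ball * leb R (n * n) (hits S c v))%E.
  rewrite -integral_if; [|exact: measurable_punctured_ball|exact: measure_ge0].
  apply: eq_integral => x _; case: asboolP => bx; last first.
    rewrite (_ : [set w | _] = set0) ?measure0//.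
    by apply/seteqP; split=> w //= -[].
  rewrite -(@leb_hits_const _ _ S mS c ((enorm x)^-1 *: x) v)//.
    by congr (leb R _ _); apply/seteqP; split=> w /=; rewrite /E/=; tauto.
  case/andP: bx => x0 _; rewrite enormZ ger0_norm ?invr_ge0 ?enorm_ge0//.
  by rewrite mulVf// gt_eqF.
move=> ->.
rewrite -integral_if; [|exact: measurable_frames|exact: measure_ge0].
apply: eq_integral => w _; case: asboolP => fw; last first.
  rewrite (_ : [set x | _] = set0) ?measure0//.
  by apply/seteqP; split=> x //= -[_ []].
have QQ : (frame w)^T *m (frame w)^T^T = 1%:M by rewrite trmxK; apply: mulmx1C; exact: fw.2.
rewrite -(isometry_mulmx QQ measurable_punctured_cone).
congr (leb R _ _); apply/seteqP.
suff e x : E (x, w) <-> punctured_cone (x *m (frame w)^T) by split=> x /e.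
by rewrite /E /hits /punctured_cone /punctured_ball/= enorm_mulmx// scalemxAl; tauto.
Qed.

(** The sum of measures is the integral of the number of arcs of a digraph depending on the frame,
    so [arcs_le] bounds the integrand pointwise. *)
Lemma sum_hits_le c (u : 'I_n.+1 -> V) : Delta_free S ->
  (\sum_(p : 'I_n.+1 * 'I_n.+1)
     leb R (n * n) (if p.1 == p.2 then set0 else hits S c (u p.1 - u p.2)) <=
   ((n.+1 ^ 2)./2)%:R%:E * leb R (n * n) (@frames R n c))%E.
Proof.
move=> dfS.
pose H (p : 'I_n.+1 * 'I_n.+1) := if p.1 == p.2 then set0 else hits S c (u p.1 - u p.2).
have mH p : measurable (H p).
  by rewrite /H; case: ifP => // _; exact: measurable_hits.
rewrite (eq_bigr (fun p => \int[leb R (n * n)]_w (\1_(H p) w : R)%:E)%E); last first.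
  by move=> p _; rewrite integral_indic// setIT.
rewrite -ge0_integral_sum//; last by move=> p; exact/measurable_EFinP/measurable_indic.
have mfr := @measurable_frames R n c.
have <- : (\int[leb R (n * n)]_w (\1_(@frames R n c) w : R)%:E = leb R (n * n) (@frames R n c))%E.
  by rewrite integral_indic// setIT.
rewrite -ge0_integralZl//; last exact/measurable_EFinP/measurable_indic.
apply: ge0_le_integral => //.
- by move=> w _; apply: sume_ge0 => p; rewrite lee_fin.
- by apply: emeasurable_sum => p; exact/measurable_EFinP/measurable_indic.
- by apply: measurable_funeM; exact/measurable_EFinP/measurable_indic.
move=> w _; rewrite sumEFin -EFinM lee_fin.
have [fw|nfw] := pselect (frames c w); last first.
  rewrite big1 ?mulr_ge0// => p _; rewrite indicE memNset// /H.
  by case: ifP => // _ [].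
pose e : rel 'I_n.+1 := fun i j => (i != j) && `[< S ((u i - u j) *m (frame w)^T) >].
have no3 x y z : ~~ [&& e x y, e y z & e z x].
  (* The three differences around a directed triangle telescope to zero, and so do their images,
     contradicting [Delta_free S]. *)
  apply/negP => /and3P[/andP[_ /asboolP a] /andP[_ /asboolP b] /andP[_ /asboolP d]].
  apply: dfS; do 3!eexists; split; [exact: a|exact: b|exact: d|].
  by rewrite -!mulmxDl !addrA !subrK subrr mul0mx.
rewrite [\1__ w]indicE mem_set// mulr1.
rewrite -[leLHS](_ : (arcs e [set: 'I_n.+1])%:R = _).
  by rewrite ler_nat; have := arcs_le no3 [set: 'I_n.+1]; rewrite cardsT card_ord.
rewrite /arcs natr_sum -(pair_bigA _ (fun i j => \1_(H (i, j)) w))/=.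
apply: eq_big => [i|i _]; first by rewrite inE.
rewrite natr_sum; apply: eq_big => [j|j _]; first by rewrite inE.
rewrite indicE /e /H/=; case: eqVneq => [_|_]/=; first by rewrite in_set0.
by congr (nat_of_bool _)%:R; apply: asbool_equiv_eq; split=> [|[]//]; split.
Qed.

End averaging.

(** * Volumes of cones over subsets of the sphere *)

Section cone_measure.
Context (R : realType).

Lemma exists_unit n : exists x : 'rV[R]_n.+1, enorm x = 1.
Proof.
exists (delta_mx 0 0); rewrite /enorm (bigD1 ord0)//= mxE !eqxx expr1n big1 ?addr0 ?sqrtr1//.
by move=> i /negbTE i0; rewrite mxE i0 andbF expr0n.
Qed.

(** A nonzero point [t *: s] of the cone determines [t] as its norm and [s] as its direction;
    [t = 0] contributes the origin exactly when [S] is nonempty. *)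
Lemma coneE n (S : set 'rV[R]_n) : S `<=` @usphere R n ->
  cone S = punctured_cone S `|` [set x | x = 0 /\ S !=set0].
Proof.
move=> S1; apply/seteqP; split=> [_ [t t01 [s Ss <-]]|x [[/andP[x0 x1] Sx]|[-> [s Ss]]]].
- move: t01; rewrite /= in_itv/= => /andP[t0 t1].
  have s1 : enorm s = 1 by exact: S1.
  have ts : enorm (t *: s) = t by rewrite enormZ s1 mulr1 ger0_norm.
  have [->|tn0] := eqVneq t 0; first by right; rewrite scale0r; split => //; exists s.
  by left; rewrite /punctured_cone /punctured_ball/= ts lt_def tn0 t0 t1 scalerA mulVf// scale1r.
- exists (enorm x); first by rewrite /= in_itv/= ltW.
  by exists ((enorm x)^-1 *: x) => //; rewrite scalerA mulfV ?scale1r// gt_eqF.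
- by exists 0; [rewrite /= in_itv/= lexx ler01|exists s => //; rewrite scale0r].
Qed.

Lemma cone_usphere n : cone (@usphere R n.+1) = eball 1.
Proof.
rewrite coneE//; apply/seteqP; split=> x.
  by case=> [[/andP[]]//|[->] _]; rewrite /eball/= enorm0 ler01.
rewrite /eball/= => x1; have [->|x0] := eqVneq x 0.
  by right; split=> //; exact: exists_unit.
have xp : 0 < enorm x by rewrite lt_def enorm_eq0 x0 enorm_ge0.
left; rewrite /punctured_cone /punctured_ball /usphere/= xp x1; split=> //.
by rewrite enormZ gtr0_norm ?invr_gt0// mulVf// gt_eqF.
Qed.

Lemma measurable_cone n (S : set 'rV[R]_n) : S `<=` @usphere R n ->
  measurable S -> measurable (cone S).
Proof.
move=> S1 mS; rewrite coneE//; apply: measurableU; first exact: measurable_punctured_cone.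
have [S0|S0] := pselect (S !=set0).
  rewrite (_ : [set x | _] = [set 0]); first exact: measurable_rV1.
  by apply/seteqP; split=> x /= => [[]|->].
rewrite (_ : [set x | _] = set0)//.
by apply/seteqP; split=> x //= -[].
Qed.

Lemma leb_cone_le n (S : set 'rV[R]_n.+1) : S `<=` @usphere R n.+1 ->
  measurable S -> (leb R n.+1 (cone S) <= leb R n.+1 (punctured_cone S))%E.
Proof.
move=> S1 mS; have mC := measurable_punctured_cone mS.
apply: (@le_trans _ _ (leb R n.+1 (punctured_cone S `|` [set 0]))).
  apply: le_measure; rewrite ?inE; first exact: measurable_cone.
    by apply: measurableU => //; exact: measurable_rV1.
  by rewrite coneE// => x [|[]]; [left|right].
apply: (le_trans (measureU2 _ _ _)) => //; first exact: measurable_rV1.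
by rewrite -[leRHS]adde0; apply: leeD => //; rewrite -(leb_origin R n).
Qed.

(** In dimension [n + 1] the simplex has [n + 2] vertices, hence [(n + 2) (n + 1)] ordered pairs of
    distinct vertices, all with the same hitting measure [k]. Eliminating [k] between [sum_hits_le]
    and [leb_hits_cone] gives the bound. *)
Lemma leb_cone_usphere_le n (S : set 'rV[R]_n.+1) :
    S `<=` @usphere R n.+1 -> measurable S -> Delta_free S ->
  ((n.+2 * n.+1)%:R%:E * leb R n.+1 (cone S) <=
   ((n.+2 ^ 2)./2)%:R%:E * leb R n.+1 (eball 1))%E.
Proof.
move=> S1 mS dfS.
have [c g0] := frames_gt0 R n.+1; have goo := @frames_fin R n.+1 c.
have [u u1] := @regular_simplex R _ (ltn0Sn n).
have [v v1] := exists_unit n.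
have := sum_hits_le mS c u dfS.
have := leb_hits_cone mS c v1.
set g := leb _ _ (frames c) in g0 goo *; set k := leb _ _ (hits S c v).
have koo : (k < +oo)%E.
  apply: le_lt_trans goo; apply: le_measure; rewrite ?inE.
  - exact: measurable_hits.
  - exact: measurable_frames.
  - by move=> w [].
have k0 : (0 <= k)%E by exact: measure_ge0.
have sumk : (\sum_(p : 'I_n.+2 * 'I_n.+2)
    leb R (n.+1 * n.+1) (if p.1 == p.2 then set0 else hits S c (u p.1 - u p.2)) =
    (n.+2 * n.+1)%:R%:E * k)%E.
  have kfin : k \is a fin_num by rewrite ge0_fin_numE.
  rewrite -(fineK kfin) -EFinM.
  rewrite (eq_bigr (fun p : 'I_n.+2 * 'I_n.+2 => (if p.1 == p.2 then 0 else fine k)%:E)).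
    rewrite sumEFin -(pair_bigA _ (fun i j => if i == j then 0 else fine k))/=; congr EFin.
    rewrite (eq_bigr (fun=> fine k *+ n.+1)).
      by rewrite sumr_const card_ord -mulrnA mulr_natl mulnC.
    move=> i _; rewrite (bigD1 i)//= eqxx add0r.
    rewrite (eq_bigr (fun=> fine k)); first by rewrite sumr_const cardC1 card_ord.
    by move=> j /negbTE ji; rewrite eq_sym ji.
  move=> [i j] _ /=; case: eqVneq => ij; first by rewrite measure0.
  by rewrite (leb_hits_const mS c (u1 _ _ ij) v1) fineK.
rewrite {}sumk.
have mB := @measurable_punctured_ball R n.+1.
have b1 : (leb R n.+1 (@punctured_ball R n.+1) <= leb R n.+1 (eball 1))%E.
  apply: le_measure; rewrite ?inE//; first exact: measurable_eball.
  by move=> x /andP[].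
have b2 := @eball_fin R n.+1 1.
have a1 := leb_cone_le S1 mS.
have a2 : (leb R n.+1 (punctured_cone S) <= leb R n.+1 (@punctured_ball R n.+1))%E.
  apply: le_measure; rewrite ?inE//; first exact: measurable_punctured_cone.
  by move=> x [].
have b3 := le_lt_trans b1 b2; have a3 := le_lt_trans a2 b3; have l3 := le_lt_trans a1 a3.
(* All measures involved are finite; passing to reals allows cancelling the positive mass of
   [frames c]. *)
have fin (x : \bar R) : (0 <= x)%E -> (x < +oo)%E -> exists2 r : R, x = r%:E & 0 <= r.
  by case: x => [r|//|//]; exists r.
have [kr -> kr0] := fin _ k0 koo.
have [gr gE gr0] := fin _ (ltW g0) goo; rewrite gE in g0 *.
have [br brE br0] := fin _ (measure_ge0 _ _) b2; rewrite brE in b1 *.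
have [b'r b'E b'r0] := fin _ (measure_ge0 (leb R n.+1) _) b3; rewrite b'E in b1 *.
have [ar aE ar0] := fin _ (measure_ge0 (leb R n.+1) _) a3; rewrite aE in a1 *.
have [lr lE lr0] := fin _ (measure_ge0 (leb R n.+1) _) l3; rewrite lE in a1 *.
move: a1 b1 g0; rewrite -!EFinM !lee_fin lte_fin => la bb gr_gt0 [kg] Mg.
rewrite -(ler_pM2l gr_gt0).
set N := _%:R in Mg *; set M := _%:R in Mg *.
have N0 : 0 <= N by exact: ler0n.
have M0 : 0 <= M by exact: ler0n.
(* The chain is [gr N lr <= N gr ar = b'r N kr <= b'r M gr <= gr M br]. *)
apply: (@le_trans _ _ (N * (gr * ar))).
  by rewrite mulrCA; do 2!apply: ler_wpM2l => //.
have -> : N * (gr * ar) = b'r * (N * kr) by rewrite -kg mulrCA.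
apply: (le_trans (ler_wpM2l b'r0 Mg)).
have -> : b'r * (M * gr) = gr * (M * b'r) by ring.
by do 2!apply: ler_wpM2l => //.
Qed.

End cone_measure.

Theorem theorem1p4 (R : realType) (d : nat) (hd : (0 < d)%N) :
  (tau R d <= (if odd d then 1 / 2 + 1 / (2 * d%:R)
               else 1 / 2 + 1 / (2 * (d%:R + 1)))%:E)%E.
Proof.
apply: ge_ereal_sup => _ [S [S1 bS dfS] <-].
have mS := borel_measurable_rV bS.
case: d hd S S1 bS dfS mS => // n _ S S1 bS dfS mS.
have cone_le := leb_cone_usphere_le S1 mS dfS.
have ball0 := @eball_gt0 R n.+1 1 ltr01; have ballfin := @eball_fin R n.+1 1.
rewrite /sphere_prob /surface_measure cone_usphere -!lebE; last 2 first.
- exact: measurable_eball.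
- exact: measurable_cone.
have c0 : (0 <= leb R n.+1 (cone S))%E by exact: measure_ge0.
move: c0 ball0 ballfin cone_le.
move: (leb R n.+1 (cone S)) (leb R n.+1 (eball 1)) => x [b| |]// x0 b0 _.
(* An infinite cone volume would contradict [cone_le], as the ball has finite volume. *)
case: x x0 => [a a0|_|//]; last by rewrite mulry gtr0_sg ?ltr0n// mul1e leye_eq.
rewrite -!EFinM !lee_fin => ab; rewrite lte_fin in b0.
have n0 : 0 < n.+1%:R :> R by [].
rewrite inver mulf_eq0 (gt_eqF n0) (gt_eqF b0)/= -EFinM lee_fin.
rewrite -mulf_div divff ?gt_eqF// mul1r ler_pdivrMr//.
have n2 : 0 < (n.+2 * n.+1)%:R :> R by rewrite ltr0n.
rewrite -(ler_pM2l n2) (le_trans ab)// mulrA ler_wpM2r ?(ltW b0)//.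
(* With [d = n + 1], the halving of [(d + 1)^2] is exact for odd [d] and loses [1/2] for even [d];
   dividing by [d (d + 1)] gives the two bounds. *)
have := odd_double_half (n.+2 ^ 2); rewrite oddX/= negbK => hn.
case: ifPn => on.
  have -> : (n.+2 * n.+1)%:R * (1 / 2 + 1 / (2 * n.+1%:R)) = (n.+2 ^ 2)%:R / 2 :> R.
    by rewrite natrX natrM -natr1; field.
  by rewrite -[in leRHS]hn (negbTE on) -muln2 natrM; lra.
have -> : (n.+2 * n.+1)%:R * (1 / 2 + 1 / (2 * (n.+1%:R + 1))) =
    ((n.+2 ^ 2)%:R - 1) / 2 :> R.
  by rewrite natrX natrM -natr1; field.
by rewrite -[in leRHS]hn (negbNE on) -muln2 natrD natrM/=; lra.
Qed.
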